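(* Every F-noetherian ring is basic. In particular, every F-noetherian ring has the full SRC and is fully stably finite.
   Context: All rings have an identity $1$, subrings contain $1$, and modules are unital; ''noetherian'' means left and right noetherian. A ring $R$ is F-noetherian if every finite subset of $R$ is contained in a noetherian subring of $R$. A ring $R$ is basic if, for (right or left) $R$-modules $A$ and $M$ with $M$ finitely generated, whenever there exist an epimorphism $f:A\to M$ and a monomorphism $i:A\to M$, then $f$ is an isomorphism. A ring $R$ has the full SRC if, for (right or left) $R$-modules $M$ and $N$ with $M$ finitely generated, $M\oplus N$ cannot be embedded in $M$ unless $N=0$. A ring $R$ is fully stably finite if every epimorphism $M\to M$ of a finitely generated (right or left) $R$-module $M$ is an isomorphism. *)

(* Defs.v *)
From HB Require Import structures.
From mathcomp Require Import all_boot all_algebra.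
From mathcomp Require Import boolp classical_sets cardinality.

Set Implicit Arguments.
Unset Strict Implicit.
Unset Printing Implicit Defensive.

Import GRing.Theory.

Local Open Scope classical_set_scope.
Local Open Scope ring_scope.

(* Rings are [pzRingType]s: associative and unital, not assumed commutative,
   and possibly zero. Right R-modules are [lmodType R^c], i.e. left modules
   over the converse ring. *)

Definition subring (R : pzRingType) (S : set R) : Prop :=
  subring_closed [in S].

(* One-sided ideals of the ring S, where S is a subring of R. *)
Definition left_ideal (R : pzRingType) (S I : set R) : Prop :=
  [/\ I `<=` S, zmod_closed [in I] &
      forall s x : R, S s -> I x -> I (s * x)].

Definition right_ideal (R : pzRingType) (S I : set R) : Prop :=
  [/\ I `<=` S, zmod_closed [in I] &
      forall s x : R, S s -> I x -> I (x * s)].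

Definition ascending_chain_condition (T : Type) (P : set T -> Prop) : Prop :=
  forall I : nat -> set T,
    (forall n, P (I n)) -> (forall n, I n `<=` I n.+1) ->
    exists N : nat, forall n : nat, (N <= n)%N -> I n = I N.

Definition noetherian_subring (R : pzRingType) (S : set R) : Prop :=
  [/\ subring S, ascending_chain_condition (left_ideal S) &
      ascending_chain_condition (right_ideal S)].

Definition F_noetherian (R : pzRingType) : Prop :=
  forall F : set R, finite_set F ->
    exists S : set R, noetherian_subring S /\ F `<=` S.

Definition finitely_generated (R : pzRingType) (M : lmodType R) : Prop :=
  exists (n : nat) (g : 'I_n -> M),
    forall x : M, exists a : 'I_n -> R, x = \sum_(i < n) a i *: g i.

Definition surjective (A B : Type) (f : A -> B) : Prop :=
  forall y : B, exists x : A, f x = y.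

Definition left_basic (R : pzRingType) : Prop :=
  forall (A M : lmodType R) (f i : {linear A -> M}),
    finitely_generated M -> surjective f -> injective i -> bijective f.

Definition basic (R : pzRingType) : Prop := left_basic R /\ left_basic R^c.

Definition left_full_SRC (R : pzRingType) : Prop :=
  forall M N : lmodType R, finitely_generated M ->
    (exists f : {linear (M * N)%type -> M}, injective f) ->
    forall x : N, x = 0.

Definition full_SRC (R : pzRingType) : Prop :=
  left_full_SRC R /\ left_full_SRC R^c.

Definition left_fully_stably_finite (R : pzRingType) : Prop :=
  forall (M : lmodType R) (f : {linear M -> M}),
    finitely_generated M -> surjective f -> bijective f.

Definition fully_stably_finite (R : pzRingType) : Prop :=
  left_fully_stably_finite R /\ left_fully_stably_finite R^c.

(* Main.v *)
Require Import Defs.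
From mathcomp Require Import all_boot all_algebra.
From mathcomp Require Import boolp classical_sets cardinality.

Set Implicit Arguments.
Unset Strict Implicit.
Unset Printing Implicit Defensive.

Import GRing.Theory.

Local Open Scope classical_set_scope.
Local Open Scope ring_scope.

(** Let M be generated by g_1, ..., g_n over an F-noetherian ring, let
    f : A -> M be onto and i : A -> M one-to-one, and let f z = 0.  Lift each
    g_k to some a_k along f.  Only finitely many coefficients are needed to
    write i z and all the i a_k in terms of the generators, so they lie in a
    noetherian subring S.  Let Q be the S-span of the g_k and P the preimage
    of Q under i.  Then P contains z and the a_k, hence f maps P onto a set
    containing Q, while i embeds P in Q.  The problem is thereby reduced to a
    module Q over S, finitely generated and therefore noetherian ([acc_span]).

    For such a Q, consider the iterated kernels K_0 = 0 and
    K_(n+1) = i (f^-1 K_n) inside Q.  They increase, so two consecutive ones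
    agree; since f is onto Q and i is one-to-one, an equality
    K_(n+2) = K_(n+1) descends to K_(n+1) = K_n, and finally to K_1 = K_0,
    which says that f is injective on P ([acc_kernel_trivial]).

    The strong rank condition is the case of the projection M * N -> M, and
    stable finiteness the case A = M, i = id.  Right modules are handled by
    passing to the converse ring, which exchanges left and right ideals. *)

(** * Submodules over a subring *)

(** The module is over the whole ring R, but only the scalars from S act. *)
Definition submodule (R : pzRingType) (S : set R) (M : lmodType R)
    (N : set M) : Prop :=
  zmod_closed [in N] /\ forall (s : R) (x : M), S s -> N x -> N (s *: x).

(** Adding the generators one at a time makes the chain condition provable
    by induction on the list. *)
Fixpoint span (R : pzRingType) (S : set R) (M : lmodType R)
    (gs : seq M) : set M :=
  if gs is g :: gs' then
    [set x | exists s y, [/\ S s, span S gs' y & x = s *: g + y]]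
  else [set 0].

Lemma zmod_closed_setP (V : zmodType) (N : set V) :
  zmod_closed [in N] <-> N 0 /\ forall x y, N x -> N y -> N (x - y).
Proof.
split=> -[N0 NB]; split=> [|x y Nx Ny].
- by move: N0; rewrite inE.
- by have := NB x y; rewrite !inE; apply.
- by rewrite inE.
- by move: Nx Ny; rewrite !inE; exact: NB.
Qed.

Lemma zmod_closed_setD (V : zmodType) (N : set V) (x y : V) :
  zmod_closed [in N] -> N x -> N y -> N (x + y).
Proof.
move=> /zmod_closed_setP[N0 NB] Nx Ny; rewrite -[y]opprK -[- y]add0r.
by apply: (NB) => //; apply: NB.
Qed.

Lemma subring_zmod_closed (R : pzRingType) (S : set R) :
  subring S -> zmod_closed [in S].
Proof. by exact: GRing.subring_closedB. Qed.

Lemma subring1 (R : pzRingType) (S : set R) : subring S -> S 1.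
Proof. by move=> [+ _ _]; rewrite inE. Qed.

Lemma subringM (R : pzRingType) (S : set R) (s t : R) :
  subring S -> S s -> S t -> S (s * t).
Proof. by move=> [_ _ SM] Ss St; have := SM s t; rewrite !inE; apply. Qed.

Section Submodules.
Variables (R : pzRingType) (S : set R).
Hypothesis S_subring : subring S.

Lemma submodule0 (M : lmodType R) : submodule S [set (0 : M)].
Proof.
split; first by apply/zmod_closed_setP; split=> // x y -> ->; rewrite subr0.
by move=> s x _ ->; rewrite /= scaler0.
Qed.

Lemma submoduleI (M : lmodType R) (N N' : set M) :
  submodule S N -> submodule S N' -> submodule S (N `&` N').
Proof.
move=> [/zmod_closed_setP[N0 NB] NZ] [/zmod_closed_setP[N'0 N'B] N'Z].
split; last by move=> s x Ss [Nx N'x]; split; [exact: NZ | exact: N'Z].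
apply/zmod_closed_setP; split=> // x y [Nx N'x] [Ny N'y].
by split; [exact: NB | exact: N'B].
Qed.

Lemma submodule_preimage (A M : lmodType R) (f : {linear A -> M}) (N : set M) :
  submodule S N -> submodule S (f @^-1` N).
Proof.
move=> [/zmod_closed_setP[N0 NB] NZ]; split.
  apply/zmod_closed_setP; split=> [|x y Nx Ny]; first by rewrite /= linear0.
  by rewrite /= linearB; exact: NB.
by move=> s x Ss Nx; rewrite /= linearZ; exact: NZ.
Qed.

Lemma submodule_image (A M : lmodType R) (f : {linear A -> M}) (N : set A) :
  submodule S N -> submodule S (f @` N).
Proof.
move=> [/zmod_closed_setP[N0 NB] NZ]; split.
  apply/zmod_closed_setP; split; first by exists 0; rewrite ?linear0.
  move=> _ _ [x Nx <-] [y Ny <-].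
  by exists (x - y); [exact: NB | rewrite linearB].
by move=> s _ Ss [x Nx <-]; exists (s *: x); [exact: NZ | rewrite linearZ].
Qed.

Lemma submodule_sum (M : lmodType R) (N : set M) (n : nat)
    (c : 'I_n -> R) (g : 'I_n -> M) :
    submodule S N -> (forall k, S (c k)) -> (forall k, N (g k)) ->
  N (\sum_(k < n) c k *: g k).
Proof.
move=> [Nzmod NZ] Sc Ng; have /zmod_closed_setP[N0 _] := Nzmod.
apply: big_ind => // [x y|k _]; first exact: zmod_closed_setD.
exact: NZ.
Qed.

Lemma span_submodule (M : lmodType R) (gs : seq M) : submodule S (span S gs).
Proof.
have /zmod_closed_setP[S0 SB] := subring_zmod_closed S_subring.
elim: gs => [|g gs [/zmod_closed_setP[gs0 gsB] gsZ]]; first exact: submodule0.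
split; first (apply/zmod_closed_setP; split).
- by exists 0, 0; split; rewrite ?scale0r ?addr0.
- move=> _ _ [s [x [Ss gsx ->]]] [t [y [St gsy ->]]].
  exists (s - t), (x - y).
  by split; [exact: SB | exact: gsB | rewrite scalerBl opprD addrACA].
- move=> s _ Ss [t [y [St gsy ->]]]; exists (s * t), (s *: y).
  by split; [exact: subringM | exact: gsZ | rewrite scalerDr scalerA].
Qed.

Lemma mem_span (M : lmodType R) (gs : seq M) (g : M) :
  g \in gs -> span S gs g.
Proof.
have /zmod_closed_setP[S0 _] := subring_zmod_closed S_subring.
elim: gs => //= h gs IHgs; rewrite inE => /predU1P[->|/IHgs gsg].
  have [/zmod_closed_setP[gs0 _] _] := span_submodule gs.
  by exists 1, 0; split; rewrite ?scale1r ?addr0 //; exact: subring1.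
by exists 0, g; split; rewrite ?scale0r ?add0r.
Qed.

Lemma span_min (M : lmodType R) (gs : seq M) (N : set M) :
  submodule S N -> (forall g, g \in gs -> N g) -> span S gs `<=` N.
Proof.
move=> [Nzmod NZ]; have /zmod_closed_setP[N0 _] := Nzmod.
elim: gs => [_ x -> //|g gs IHgs Ngs x [s [y [Ss gsy ->]]]].
apply: zmod_closed_setD => //.
  by apply: NZ => //; apply: Ngs; exact: mem_head.
by apply: IHgs gsy => h gsh; apply: Ngs; rewrite inE gsh orbT.
Qed.

(** * The ascending chain condition for finitely generated modules *)

(** The coefficients of the new generator in the elements of a submodule N of
    S g + U form a left ideal of S.  Together with N :&: U, this ideal
    controls N, as in the argument that an extension of noetherian modules
    is noetherian. *)
Definition leading_coefs (M : lmodType R) (U : set M) (g : M) (N : set M) :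
    set R :=
  [set s | S s /\ exists2 y, U y & N (s *: g + y)].

Lemma leading_coefs_left_ideal (M : lmodType R) (U : set M) (g : M)
    (N : set M) :
  submodule S U -> submodule S N -> left_ideal S (leading_coefs U g N).
Proof.
have /zmod_closed_setP[S0 SB] := subring_zmod_closed S_subring.
move=> [/zmod_closed_setP[U0 UB] UZ] [/zmod_closed_setP[N0 NB] NZ].
split=> [s [] //||s t Ss [St [y Uy Ny]]].
  apply/zmod_closed_setP; split.
    by split=> //; exists 0; rewrite ?scale0r ?addr0.
  move=> s t [Ss [x Ux Nx]] [St [y Uy Ny]]; split; first exact: SB.
  exists (x - y); first exact: UB.
  by rewrite scalerBl addrACA -opprD; exact: NB.
split; first exact: subringM.
by exists (s *: y); [exact: UZ | rewrite -scalerA -scalerDr; exact: NZ].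
Qed.

(** An element s g + y of the larger module N' has a counterpart s g + y' in
    N with the same leading coefficient, and their difference lies in U. *)
Lemma leading_coefs_sub (M : lmodType R) (U : set M) (g : M) (N N' : set M) :
    submodule S U -> submodule S N -> submodule S N' ->
    N `<=` N' -> N' `<=` [set x | exists s y, [/\ S s, U y & x = s *: g + y]] ->
    leading_coefs U g N' `<=` leading_coefs U g N -> N' `&` U `<=` N `&` U ->
  N' `<=` N.
Proof.
move=> [/zmod_closed_setP[_ UB] _] [Nzmod _] [/zmod_closed_setP[_ N'B] _].
move=> NN' N'span leadN' N'UN x N'x.
have [s [y [Ss Uy xE]]] := N'span x N'x.
have [_ [y' Uy' Ny']] : leading_coefs U g N s.
  by apply: leadN'; split=> //; exists y; rewrite -?xE.
have xy' : x - (s *: g + y') = y - y'.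
  by rewrite xE opprD addrACA subrr add0r.
rewrite -[x](subrK (s *: g + y')); apply: zmod_closed_setD => //.
have [] // : (N `&` U) (x - (s *: g + y')).
apply: N'UN; split; first by apply: N'B => //; exact: NN'.
by rewrite xy'; exact: UB.
Qed.

Lemma chain_sub (T : Type) (I : nat -> set T) :
  (forall n, I n `<=` I n.+1) -> forall m n, (m <= n)%N -> I m `<=` I n.
Proof.
move=> I_S m n /subnK <-; elim: (n - m)%N => [//|k IHk].
exact: subset_trans IHk (I_S _).
Qed.

Lemma acc_span (M : lmodType R) (gs : seq M) :
    ascending_chain_condition (left_ideal S) ->
  ascending_chain_condition
    (fun N : set M => submodule S N /\ N `<=` span S gs).
Proof.
move=> accS; elim: gs => [|g gs IHgs] N subN incN.
  exists 0%N => n _; have N_eq0 k : N k = [set 0].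
    have [[/zmod_closed_setP[Nk0 _] _] Nk_sub] := subN k.
    by apply/seteqP; split=> // x ->.
  by rewrite !N_eq0.
have span_sub := span_submodule gs.
have [n1 lead_stab] : exists n1, forall n, (n1 <= n)%N ->
    leading_coefs (span S gs) g (N n) = leading_coefs (span S gs) g (N n1).
  apply: accS => n.
    by apply: leading_coefs_left_ideal => //; case: (subN n).
  by move=> s [Ss [y gsy Ny]]; split=> //; exists y => //; exact: incN.
have [n2 tail_stab] : exists n2, forall n, (n2 <= n)%N ->
    N n `&` span S gs = N n2 `&` span S gs.
  apply: (IHgs (fun n => N n `&` span S gs)) => n.
    by split=> [|x [] //]; apply: submoduleI => //; case: (subN n).
  by move=> x [Nx gsx]; split=> //; exact: incN.
exists (maxn n1 n2) => n le_n; move: (le_n); rewrite geq_max => /andP[le1 le2].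
have incl := chain_sub incN le_n.
have [Nn_sub Nn_span] := subN n; have [Nm_sub _] := subN (maxn n1 n2).
apply/seteqP; split=> //.
apply: (leading_coefs_sub span_sub Nm_sub Nn_sub incl Nn_span).
  by rewrite lead_stab // -(lead_stab _ (leq_maxl n1 n2)).
by rewrite tail_stab // -(tail_stab _ (leq_maxr n1 n2)).
Qed.

(** * Iterated kernels *)

(** The kernels of the powers of the partial endomorphism f i^-1 of Q, which
    is defined on the image of i. *)
Fixpoint iter_ker (A M : lmodType R) (f i : A -> M) (Q : set M) (n : nat) :
    set M :=
  if n is n'.+1 then Q `&` i @` (f @^-1` iter_ker f i Q n') else [set 0].

(** A stationary chain of iterated kernels forces the first of them, the kernel
    of f on the preimage of Q, to vanish: if x = f y lies in K_(n+1) then i y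
    lies in K_(n+2) = K_(n+1), so injectivity of i puts x = f y in K_n. *)
Lemma acc_kernel_trivial (A M : lmodType R) (f i : {linear A -> M})
    (Q : set M) (z : A) :
    submodule S Q ->
    ascending_chain_condition (fun N : set M => submodule S N /\ N `<=` Q) ->
    injective i -> Q `<=` f @` (i @^-1` Q) ->
  Q (i z) -> f z = 0 -> z = 0.
Proof.
move=> subQ accQ i_inj f_onto Qz fz0.
pose K := iter_ker f i Q.
have K_S n : K n.+1 = Q `&` i @` (f @^-1` K n) by [].
have [/zmod_closed_setP[Q0 _] _] := subQ.
have subK n : submodule S (K n) /\ K n `<=` Q.
  elim: n => [|n [IHn _]]; first by split; [exact: submodule0 | move=> x ->].
  split; last by move=> x [].
  by apply/submoduleI/submodule_image/submodule_preimage.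
have incK n : K n `<=` K n.+1.
  elim: n => [|n IHn] x.
    by move=> ->; split=> //; exists 0; rewrite /= ?linear0.
  by rewrite !K_S => -[Qx [y Ky yx]]; split=> //; exists y => //; exact: IHn.
have descend n : K n.+2 = K n.+1 -> K n.+1 = K n.
  move=> stab; apply/seteqP; split=> // x Kx.
  have [y Qy fy] : (f @` (i @^-1` Q)) x.
    by apply: f_onto; case: (subK n.+1) => _; exact.
  have : K n.+2 (i y) by split=> //; exists y; rewrite //= fy.
  by rewrite stab => -[_ [y' Ky' /i_inj yy']]; rewrite -fy -yy'.
have [m stab] := accQ K subK incK.
have K1 : K 1%N = K 0%N.
  (* The stationary step moves down the chain to its start. *)
  have : K m.+1 = K m by rewrite stab.
  by elim: m {stab} => // n IHn /descend.
apply: i_inj; rewrite linear0.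
have : K 1%N (i z) by split=> //; exists z.
by rewrite K1.
Qed.

End Submodules.

(** * Reduction to a noetherian subring *)

Lemma inj_surj_bij (A B : Type) (f : A -> B) :
  injective f -> surjective f -> bijective f.
Proof.
move=> f_inj /choice[h hK]; exists h => // x.
by apply: f_inj; rewrite hK.
Qed.

Lemma F_noetherian_left_basic (R : pzRingType) :
  F_noetherian R -> left_basic R.
Proof.
move=> noethR A M f i [n [g genM]] f_surj i_inj.
apply: inj_surj_bij => //; apply: raddf_inj => z fz0.
have /fin_all_exists[a fa] : forall k, exists x, f x = g k.
  by move=> k; exact: f_surj.
(* None stands for z and Some k for the chosen preimage of g k. *)
pose b (o : option 'I_n) : A := if o is Some k then a k else z.
have /fin_all_exists[c cE] : forall o, exists c : 'I_n -> R,
    i (b o) = \sum_(k < n) c k *: g k.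
  by move=> o; exact: genM.
have /noethR[S [[subS accS _] cS]] :
  finite_set (range (fun p : option 'I_n * 'I_n => c p.1 p.2)).
  exact/finite_image/finite_finset.
pose Q := span S (codom g).
have subQ : submodule S Q by exact: span_submodule.
have Qb o : Q (i (b o)).
  rewrite cE; apply: (submodule_sum subQ) => k; last exact/mem_span/codom_f.
  by apply: cS; exists (o, k).
apply: (acc_kernel_trivial subQ (acc_span (gs := codom g) subS accS) i_inj _
          (Qb None) fz0).
apply: span_min; first exact/submodule_image/submodule_preimage.
by move=> _ /codomP[k ->]; exists (a k); [exact: (Qb (Some k)) | exact: fa].
Qed.

Lemma left_basic_full_SRC (R : pzRingType) : left_basic R -> left_full_SRC R.
Proof.
move=> basicR M N fgM [i i_inj] x.
have fst_surj : surjective (fst : M * N -> M) by move=> y; exists (y, 0).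
have /bij_inj fst_inj :=
  basicR _ _ (fst : {linear (M * N)%type -> M}) i fgM fst_surj i_inj.
by case: (fst_inj (0, x) (0, 0) erefl).
Qed.

Lemma left_basic_fully_stably_finite (R : pzRingType) :
  left_basic R -> left_fully_stably_finite R.
Proof.
move=> basicR M f fgM f_surj.
by apply: (basicR M M f idfun) => //; exact: inj_id.
Qed.

Lemma F_noetherian_converse (R : pzRingType) :
  F_noetherian R -> F_noetherian R^c.
Proof.
move=> noethR F /noethR[S [[[S1 SB SM] accl accr] FS]].
exists S; split=> //; split=> //.
by split=> // s t Ss St; exact: SM.
Qed.

Theorem theorem3p4 (R : pzRingType) :
  F_noetherian R -> basic R /\ full_SRC R /\ fully_stably_finite R.
Proof.
move=> noethR.
have basicl := F_noetherian_left_basic noethR.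
have basicr := F_noetherian_left_basic (F_noetherian_converse noethR).
split; first by split.
split; split.
- exact: left_basic_full_SRC.
- exact: left_basic_full_SRC.
- exact: left_basic_fully_stably_finite.
- exact: left_basic_fully_stably_finite.
Qed.
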